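(* Let $G=(V,E)$ be a graph, $u\notin V$, and $n=|V\cup\{u\}|$ the number of vertices of $G\vee u$. The worst-case time complexity of the algorithm ACCN with primary instance $G$ and secondary instance $G\vee u$ is $O(n^3)$; that is, there is an absolute constant $c$ such that, for every such instance, the ACCN runs in at most $cn^3$ primitive computational steps.
   Context: All graphs are finite (with non-empty vertex set), simple, undirected and loop-free. For $u\notin V$, $G\vee u$ is the graph with vertex set $W=V\cup\{u\}$ whose edges are the edges of $G$ together with all $\{u,x\}$, $x\in V$. In $G\vee u$, $C(x)=N(x)\cup\{x\}$ is the closed neighbourhood of $x$. For $A\subset W$ and $z\in A$, $d_z(A)$ is the degree of $z$ in the subgraph of $G\vee u$ induced by $A$. Primitive computational steps are elementary operations such as reading a matrix entry or a stored value, comparing two integers, or assigning a value to a variable. Algorithm ACCN. Input: the vertex set and the adjacency matrix of the primary instance $G$. Phase 1: construct the vertex set and the adjacency matrix of the secondary instance $G\vee u$. Phase 2: for each $y\in W$: put $A=C(y)$; for each $z\in A$ compute $d_z(A)$; compute the largest $k$ such that there are at least $k$ vertices $z\in A$ with $d_z(A)\ge k$; set $c(y{:}u)=k+1$. Phase 3: for each $y\in W$ set $c^*(y{:}u)=c(y{:}u)$. Then, for each $y\in W$ with $y\ne u$: compute the largest $p$ such that there are at least $p$ vertices $z\in C(y)$, including $y$ and $u$ (i.e. $y$ and $u$ are among these vertices), such that $p\le c^*(z{:}u)$; set $c^*(y{:}u)=p$. Finally compute the largest $p$ such that there are at least $p$ vertices $z\in W$, including $u$, such that $p\le c^*(z{:}u)$;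 set $c^*(u{:}u)=p$ and $c^*(G\vee u)=c^*(u{:}u)$. Return $c^*(G\vee u)$. The ''largest $k$'' (respectively ''largest $p$'') is found by testing the candidate values $2,\dots,n$ in turn, each against the at most $n$ relevant stored degrees (respectively stored clique ceiling values). *)

(* Defs.v *)
From HB Require Import structures.
From mathcomp Require Import all_boot.

Set Implicit Arguments.
Unset Strict Implicit.
Unset Printing Implicit Defensive.

(** * Graphs *)

(* Finite simple graphs whose vertices form a nonempty subset of an ambient
   finite type [K], so that it makes sense to pick a further point [u] of [K]
   which is not a vertex. *)
Record graph (K : finType) := Graph {
  vertices : {set K};
  adj : rel K;
  vertices_neq0 : vertices != set0;
  adj_vertices : forall x y, adj x y -> (x \in vertices) && (y \in vertices);
  adj_sym : symmetric adj;
  adj_irrefl : irreflexive adj }.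

Section Join.

Variables (K : finType) (G : graph K) (u : K) (uV : u \notin vertices G).

Let W := u |: vertices G.

Let jadj : rel K := fun x y =>
  [|| adj G x y, (x == u) && (y \in vertices G)
    | (y == u) && (x \in vertices G)].

Fact join_neq0 : W != set0.
Proof. by apply/set0Pn; exists u; rewrite setU11. Qed.

Fact join_vertices x y : jadj x y -> (x \in W) && (y \in W).
Proof.
rewrite !inE; case/or3P => [/adj_vertices/andP[-> ->]|/andP[-> ->]|/andP[-> ->]];
  by rewrite ?orbT.
Qed.

Fact join_sym : symmetric jadj.
Proof. by move=> x y; rewrite /jadj adj_sym; congr orb; rewrite orbC. Qed.

Fact join_irrefl : irreflexive jadj.
Proof.
move=> x; rewrite /jadj adj_irrefl orbb /=.
by case: eqP => // ->; rewrite (negbTE uV).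
Qed.

(* The graph G \/ u. *)
Definition join : graph K :=
  Graph join_neq0 join_vertices join_sym join_irrefl.

End Join.

(** * A step-counting imperative language

    Programs manipulate natural numbers held in scalar variables, vectors and
    square arrays.  There is no operation on data beyond reading, writing,
    comparing, and adding one. *)

(* In order: |V|, |W|, the number of u; running vertices y, z; loop counters;
   the length of the list holding C(y); a degree; a candidate value, the count
   for this candidate, the largest successful candidate; the returned value. *)
Inductive scalar :=
  | nV | nW | vu | vy | vz | ci | cj | cl | nA | deg | cand | cnt | best | ret.

(* In order: the lists of the elements of V, W and A = C(y); then, indexed by
   vertices, z |-> d_z(A), y |-> c(y:u) and y |-> c*(y:u). *)
Inductive vector := LV | LW | LA | Deg | Ceil | CStar.

(* The adjacency matrices of G and of G \/ u. *)
Inductive array := AG | AW.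

Definition scalar_eq_dec : comparable scalar. Proof. by rewrite /comparable /decidable; decide equality. Defined.
Definition vector_eq_dec : comparable vector. Proof. by rewrite /comparable /decidable; decide equality. Defined.
Definition array_eq_dec : comparable array. Proof. by rewrite /comparable /decidable; decide equality. Defined.

HB.instance Definition _ := hasDecEq.Build scalar (compareP scalar_eq_dec).
HB.instance Definition _ := hasDecEq.Build vector (compareP vector_eq_dec).
HB.instance Definition _ := hasDecEq.Build array (compareP array_eq_dec).

Record memory := Memory {
  sca : scalar -> nat;
  vec : vector -> nat -> nat;
  arr : array -> nat -> nat -> nat }.

Inductive expr :=
  | Lit of nat
  | Var of scalar
  | Vec of vector & expr
  | Arr of array & expr & expr
  | Succ of expr.

Coercion Lit : nat >-> expr.
Coercion Var : scalar >-> expr.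

Inductive cond :=
  | Leq of expr & expr
  | Eq of expr & expr
  | And of cond & cond
  | Or of cond & cond.

(* [For x lo hi c] runs [c] for x = lo, ..., hi - 1; the bounds are evaluated
   once, on entry. *)
Inductive cmd :=
  | Skip
  | Seq of cmd & cmd
  | Set_ of scalar & expr
  | SetVec of vector & expr & expr
  | SetArr of array & expr & expr & expr
  | If of cond & cmd & cmd
  | For of scalar & expr & expr & cmd.

Definition block (cs : seq cmd) : cmd := foldr Seq Skip cs.

Fixpoint eval (s : memory) (e : expr) : nat :=
  match e with
  | Lit k => k
  | Var x => sca s x
  | Vec v e1 => vec s v (eval s e1)
  | Arr a e1 e2 => arr s a (eval s e1) (eval s e2)
  | Succ e1 => (eval s e1).+1
  end.

Fixpoint test (s : memory) (b : cond) : bool :=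
  match b with
  | Leq e1 e2 => eval s e1 <= eval s e2
  | Eq e1 e2 => eval s e1 == eval s e2
  | And b1 b2 => test s b1 && test s b2
  | Or b1 b2 => test s b1 || test s b2
  end.

Definition set_sca (s : memory) x k :=
  Memory (fun x' => if x' == x then k else sca s x') (vec s) (arr s).

Definition set_vec (s : memory) v i k :=
  Memory (sca s)
    (fun v' i' => if (v' == v) && (i' == i) then k else vec s v' i') (arr s).

Definition set_arr (s : memory) a i j k :=
  Memory (sca s) (vec s)
    (fun a' i' j' =>
       if [&& a' == a, i' == i & j' == j] then k else arr s a' i' j').

(* Every literal, read, addition of one, comparison and connective counts for
   one step; conditions are charged as if evaluated without short-circuit. *)
Fixpoint expr_cost (e : expr) : nat :=
  match e with
  | Lit _ | Var _ => 1
  | Vec _ e1 | Succ e1 => (expr_cost e1).+1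
  | Arr _ e1 e2 => (expr_cost e1 + expr_cost e2).+1
  end.

Fixpoint cond_cost (b : cond) : nat :=
  match b with
  | Leq e1 e2 | Eq e1 e2 => (expr_cost e1 + expr_cost e2).+1
  | And b1 b2 | Or b1 b2 => (cond_cost b1 + cond_cost b2).+1
  end.

(* [exec c s] is the final memory together with the number of steps.  In
   addition to the evaluations, an assignment costs one step; a loop costs one
   step for each evaluation of its exit test (one more than the number of
   iterations) and, at each iteration, two steps for incrementing and storing
   its counter. *)
Fixpoint exec (c : cmd) (s : memory) : memory * nat :=
  match c with
  | Skip => (s, 0)
  | Seq c1 c2 =>
      let: (s1, t1) := exec c1 s in
      let: (s2, t2) := exec c2 s1 in
      (s2, t1 + t2)
  | Set_ x e => (set_sca s x (eval s e), (expr_cost e).+1)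
  | SetVec v e1 e =>
      (set_vec s v (eval s e1) (eval s e), (expr_cost e1 + expr_cost e).+1)
  | SetArr a e1 e2 e =>
      (set_arr s a (eval s e1) (eval s e2) (eval s e),
       (expr_cost e1 + expr_cost e2 + expr_cost e).+1)
  | If b c1 c2 =>
      let: (s1, t1) := exec (if test s b then c1 else c2) s in
      (s1, cond_cost b + t1)
  | For x lo hi c1 =>
      foldl (fun '(s1, t1) i =>
               let: (s2, t2) := exec c1 (set_sca s1 x i) in (s2, t1 + t2 + 3))
            (s, (expr_cost lo + expr_cost hi).+1)
            (index_iota (eval s lo) (eval s hi))
  end.

Definition steps (c : cmd) (s : memory) : nat := (exec c s).2.

(** * The algorithm ACCN

    The vertices of G are numbered from 0 to |V| - 1, and u receives the
    number |V|.  Booleans are stored as 0 and 1. *)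

Definition phase1 : cmd := block [::
  Set_ nW (Succ nV);
  Set_ vu nV;
  For ci 0 nV (SetVec LW ci (Vec LV ci));
  SetVec LW nV vu;
  For ci 0 nV (For cj 0 nV (block [::
    Set_ vy (Vec LV ci);
    Set_ vz (Vec LV cj);
    SetArr AW vy vz (Arr AG vy vz)]));
  For ci 0 nV (block [::
    Set_ vy (Vec LV ci);
    SetArr AW vy vu 1;
    SetArr AW vu vy 1]);
  SetArr AW vu vu 0].

Definition for_y_in_W (c : cmd) : cmd :=
  For ci 0 nW (Seq (Set_ vy (Vec LW ci)) c).

(* A := C(y) *)
Definition closed_nbhd : cmd := block [::
  Set_ nA 0;
  For cj 0 nW (block [::
    Set_ vz (Vec LW cj);
    If (Or (Eq vz vy) (Eq (Arr AW vy vz) 1))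
       (block [:: SetVec LA nA vz; Set_ nA (Succ nA)])
       Skip])].

(* Deg[z] := d_z(A) for z in A *)
Definition degrees : cmd :=
  For cj 0 nA (block [::
    Set_ vz (Vec LA cj);
    Set_ deg 0;
    For cl 0 nA (If (Eq (Arr AW vz (Vec LA cl)) 1) (Set_ deg (Succ deg)) Skip);
    SetVec Deg vz deg]).

(* best := the largest k such that at least k of the [len] vertices z listed in
   [L] satisfy k <= S[z], and such that moreover k <= S[z] for every z in
   [required].  The value 1 is always successful in the calls below, and the
   candidates 2, ..., |W| are tested in turn. *)
Definition largest (L : vector) (len : scalar) (S : vector)
    (required : seq scalar) : cmd := block [::
  Set_ best 1;
  For cand 2 (Succ nW) (block [::
    Set_ cnt 0;
    For cl 0 len (If (Leq cand (Vec S (Vec L cl))) (Set_ cnt (Succ cnt)) Skip);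
    If (foldr (fun z : scalar => And (Leq cand (Vec S z))) (Leq cand cnt) required)
       (Set_ best cand) Skip])].

Definition phase2 : cmd :=
  for_y_in_W (block [::
    closed_nbhd;
    degrees;
    largest LA nA Deg [::];
    SetVec Ceil vy (Succ best)]).

Definition phase3 : cmd := block [::
  for_y_in_W (SetVec CStar vy (Vec Ceil vy));
  for_y_in_W (If (Eq vy vu) Skip (block [::
    closed_nbhd;
    largest LA nA CStar [:: vy; vu];
    SetVec CStar vy best]));
  largest LW nW CStar [:: vu];
  SetVec CStar vu best;
  Set_ ret (Vec CStar vu)].

Definition ACCN : cmd := block [:: phase1; phase2; phase3].

(* A listing of the vertices of G numbers them, and thereby fixes both the
   adjacency matrix and the order in which the loops over W visit V. *)
Definition listing (K : finType) (G : graph K) (vs : seq K) : Prop :=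
  uniq vs /\ vs =i vertices G.

(* The initial memory for the primary instance G; cells which are not part of
   the input hold 0. *)
Definition load (K : finType) (G : graph K) (vs : seq K) : memory :=
  Memory
    (fun x => if x == nV then size vs else 0)
    (fun v i => if (v == LV) && (i < size vs) then i else 0)
    (fun a i j =>
       if a == AG then
         if (onth vs i, onth vs j) is (Some x, Some y) then adj G x y : nat
         else 0
       else 0).

(* Main.v *)
Require Import Defs.
From mathcomp Require Import all_boot.

Set Implicit Arguments.
Unset Strict Implicit.
Unset Printing Implicit Defensive.

(** If every loop entered during a run makes at most [n] iterations, then the
    number of steps is at most [w * n ^ d], where [d] is the depth of loop
    nesting of the program and [w], the sum of the costs of its atomic parts,
    depends only on its text.  Since ACCN has nesting depth 3, it suffices to
    bound its trip counts by the number [n] of vertices of G \/ u.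

    All loops of ACCN are governed by |V|, |W| or the length of the list that
    holds C(y).  The first two of these never exceed [n], and the third is
    reset and then grows by at most one in each of the |W| iterations of the
    loop that computes C(y) ([triple_closed_nbhd]).  Apart from this and from
    the single assignment of |V| + 1 to |W|, no command touches the three of
    them, which is checked by a syntactic test ([triple_tame]).
    The constant obtained is the weight of ACCN. *)

(** * Step bounds from loop nesting *)

Fixpoint depth (c : cmd) : nat :=
  match c with
  | Seq c1 c2 | If _ c1 c2 => maxn (depth c1) (depth c2)
  | For _ _ _ c1 => (depth c1).+1
  | _ => 0
  end.

(** Both branches of a conditional are charged, and a loop is charged for one
    iteration only: the number of iterations is accounted for by [depth]. *)
Fixpoint weight (c : cmd) : nat :=
  match c with
  | Skip => 0
  | Seq c1 c2 => weight c1 + weight c2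
  | Set_ _ e => (expr_cost e).+1
  | SetVec _ e1 e => (expr_cost e1 + expr_cost e).+1
  | SetArr _ e1 e2 e => (expr_cost e1 + expr_cost e2 + expr_cost e).+1
  | If b c1 c2 => cond_cost b + (weight c1 + weight c2)
  | For _ lo hi c1 => (expr_cost lo + expr_cost hi).+1 + (weight c1 + 3)
  end.

(** A Hoare triple whose step bound is the one expected of a run in which no
    loop makes more than [n] iterations. *)
Definition triple n (P : memory -> Prop) (c : cmd) (Q : memory -> Prop) :=
  forall s, P s ->
    Q (exec c s).1 /\ steps c s <= weight c * n ^ depth c.

Lemma leq_add_max_exp n w1 w2 d1 d2 t1 t2 :
  0 < n -> t1 <= w1 * n ^ d1 -> t2 <= w2 * n ^ d2 ->
  t1 + t2 <= (w1 + w2) * n ^ maxn d1 d2.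
Proof.
move=> n0 le1 le2; rewrite mulnDl leq_add //.
  by apply: leq_trans le1 _; rewrite leq_mul2l leq_pexp2l ?leq_maxl ?orbT.
by apply: leq_trans le2 _; rewrite leq_mul2l leq_pexp2l ?leq_maxr ?orbT.
Qed.

Section Rules.

Variables (n : nat) (n_gt0 : 0 < n).
Implicit Types P Q R : memory -> Prop.

Lemma triple_skip P : triple n P Skip P.
Proof. by []. Qed.

Lemma triple_set P Q x e :
  (forall s, P s -> Q (set_sca s x (eval s e))) -> triple n P (Set_ x e) Q.
Proof. by move=> PQ s Ps; rewrite /steps /= muln1; split; first exact: PQ. Qed.

Lemma triple_setvec P Q v e1 e :
  (forall s, P s -> Q (set_vec s v (eval s e1) (eval s e))) ->
  triple n P (SetVec v e1 e) Q.
Proof. by move=> PQ s Ps; rewrite /steps /= muln1; split; first exact: PQ. Qed.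

Lemma triple_setarr P Q a e1 e2 e :
  (forall s, P s -> Q (set_arr s a (eval s e1) (eval s e2) (eval s e))) ->
  triple n P (SetArr a e1 e2 e) Q.
Proof. by move=> PQ s Ps; rewrite /steps /= muln1; split; first exact: PQ. Qed.

Lemma triple_seq P Q R c1 c2 :
  triple n P c1 Q -> triple n Q c2 R -> triple n P (Seq c1 c2) R.
Proof.
move=> h1 h2 s /h1; rewrite /steps /=.
case: (exec c1 s) => s1 t1 [/= /h2]; rewrite /steps.
by case: (exec c2 s1) => s2 t2 [/= Rs le2 le1]; split=> //; apply: leq_add_max_exp.
Qed.

Lemma triple_if P Q b c1 c2 :
  triple n P c1 Q -> triple n P c2 Q -> triple n P (If b c1 c2) Q.
Proof.
move=> h1 h2 s Ps; rewrite /steps /=.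
have: Q (exec (if test s b then c1 else c2) s).1 /\
    steps (if test s b then c1 else c2) s
      <= (weight c1 + weight c2) * n ^ maxn (depth c1) (depth c2).
  case: (test s b).
    case: (h1 s Ps) => Qs le1; split=> //.
    by rewrite -[steps _ _]addn0; apply: leq_add_max_exp.
  case: (h2 s Ps) => Qs le2; split=> //.
  by rewrite -[steps _ _]add0n; apply: leq_add_max_exp.
rewrite /steps; case: (exec _ s) => s1 t1 [/= Qs le1]; split=> //.
by rewrite mulnDl leq_add // leq_pmulr // expn_gt0 n_gt0.
Qed.

(** The invariant is indexed by the number of completed iterations rather than
    by the loop counter, so that it does not depend on the lower bound. *)
Lemma triple_for P Q (J : nat -> memory -> Prop) x lo hi c :
  (forall s, P s -> eval s hi - eval s lo <= n) ->
  (forall s, P s -> J 0 s) ->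
  (forall k s i, J k s -> J k (set_sca s x i)) ->
  (forall k, k < n -> triple n (J k) c (J k.+1)) ->
  (forall k s, k <= n -> J k s -> Q s) ->
  triple n P (For x lo hi c) Q.
Proof.
move=> trips PJ Jx Jc JQ s Ps; rewrite /steps /= /index_iota.
set step := fun _ _ => _; set B := weight c * n ^ depth c + 3.
have loop m : forall k l s0 t0, k + m <= n -> J k s0 ->
    let r := foldl step (s0, t0) (iota l m) in
    J (k + m) r.1 /\ r.2 <= t0 + m * B.
  elim: m => [|m IHm] k l s0 t0 lekm Jk /=; first by rewrite !addn0.
  have [|] := Jc k _ _ (Jx k s0 l Jk).
    by apply: leq_trans lekm; rewrite addnS ltnS leq_addr.
  rewrite /steps; case: (exec c _) => s1 t1 /= Jk1 le1.
  have [|Jm lem] := IHm k.+1 l.+1 s1 (t0 + t1 + 3) _ Jk1; first by rewrite addSnnS.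
  rewrite -addSnnS; split=> //; apply: leq_trans lem _.
  by rewrite mulSn addnA leq_add2r -addnA leq_add2l leq_add2r.
have lem := trips s Ps.
have [Jm le] := loop _ 0 (eval s lo) s (expr_cost lo + expr_cost hi).+1
  lem (PJ s Ps).
split; first exact: JQ Jm.
apply: leq_trans le _; rewrite mulnDl leq_add //.
  by rewrite leq_pmulr // expn_gt0 n_gt0.
rewrite expnS mulnCA leq_mul // mulnDl leq_add2l.
by rewrite leq_pmulr // expn_gt0 n_gt0.
Qed.

End Rules.

(** * The sizes that govern the loops *)

Definition sizes : seq scalar := [:: nV; nW; nA].

(** The length of the list holding C(y) has a bound [a] of its own, because it
    has to be followed while the list is being built.  The strict inequality
    for |V| is what allows |W| to be set to |V| + 1. *)
Definition within n a (s : memory) : Prop :=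
  [/\ sca s nV < n, sca s nW <= n & sca s nA <= a].

(** The candidates 2, ..., |W| give a loop whose upper bound is one more than a
    size; its trip count is still at most that size since it starts above 0. *)
Definition short_range (lo hi : expr) : bool :=
  match lo, hi with
  | _, Var x => x \in sizes
  | Lit k, Succ (Var x) => (0 < k) && (x \in sizes)
  | _, _ => false
  end.

(** A syntactic condition under which a command neither changes a size nor
    makes more iterations in a loop than some size. *)
Fixpoint tame (c : cmd) : bool :=
  match c with
  | Seq c1 c2 | If _ c1 c2 => tame c1 && tame c2
  | Set_ x _ => x \notin sizes
  | For x lo hi c1 => [&& x \notin sizes, short_range lo hi & tame c1]
  | _ => true
  end.

Section Sizes.

Variables (n : nat) (n_gt0 : 0 < n).

Lemma within_set_sca a s x k :
  x \notin sizes -> within n a s -> within n a (set_sca s x k).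
Proof. by case: x. Qed.

Lemma short_range_trips s lo hi :
  within n n s -> short_range lo hi -> eval s hi - eval s lo <= n.
Proof.
case=> leV leW leA.
have le_size x : x \in sizes -> sca s x <= n by case: x => // _; exact: ltnW.
case: hi => [m|x|v e|a e1 e2|[m|x|v e|a e1 e2|e]] /=; try by case: lo.
  have -> : short_range lo x = (x \in sizes) by case: lo.
  by move/le_size; apply: leq_trans; apply: leq_subr.
case: lo => [[|k]|||?|] //= /le_size; apply: leq_trans.
by rewrite subSS leq_subr.
Qed.

Lemma triple_tame a c :
  a <= n -> tame c -> triple n (within n a) c (within n a).
Proof.
move=> le_a; elim: c => //=.
- by move=> c1 IH1 c2 IH2 /andP[/IH1 h1 /IH2 h2]; apply: triple_seq h1 h2.
- by move=> x e xP; apply: triple_set => s; apply: within_set_sca.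
- by move=> *; apply: triple_setvec.
- by move=> *; apply: triple_setarr.
- by move=> b c1 IH1 c2 IH2 /andP[/IH1 h1 /IH2 h2]; apply: triple_if.
move=> x lo hi c IH /and3P[xP range /IH hc].
apply: (triple_for n_gt0 (J := fun=> within n a)) => //.
  move=> s [leV leW leA]; apply: short_range_trips range.
  by split=> //; apply: leq_trans le_a.
by move=> _ s i; apply: within_set_sca.
Qed.

(** * The steps of ACCN *)

(** After [k] iterations the list built so far has length at most [k]. *)
Lemma triple_closed_nbhd : triple n (within n n) closed_nbhd (within n n).
Proof.
apply: (triple_seq n_gt0 (Q := within n 0)); first by apply: triple_set => s [].
apply: (triple_seq n_gt0 (Q := within n n)); last exact: triple_skip.
apply: (triple_for n_gt0 (J := within n)) => //.
- by move=> s [_ leW _]; rewrite subn0.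
- move=> k lt_kn.
  apply: (triple_seq n_gt0 (Q := within n k)).
    by apply: triple_tame => //; apply: ltnW.
  apply: (triple_seq n_gt0 (Q := within n k.+1)); last exact: triple_skip.
  apply: (triple_if n_gt0); last first.
    by move=> s [leV leW leA]; split=> //; split=> //; apply: leqW.
  apply: (triple_seq n_gt0 (Q := within n k)).
    by apply: triple_tame => //; apply: ltnW.
  apply: (triple_seq n_gt0 (Q := within n k.+1)); last exact: triple_skip.
  by apply: triple_set => s [leV leW leA]; split.
- by move=> k s le_kn [leV leW leA]; split=> //; exact: leq_trans le_kn.
Qed.

Lemma triple_for_y_in_W c :
  triple n (within n n) c (within n n) ->
  triple n (within n n) (for_y_in_W c) (within n n).
Proof.
move=> hc; apply: (triple_for n_gt0 (J := fun=> within n n)) => //.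
  by move=> s ws; apply: short_range_trips ws _.
move=> _ _; apply: (triple_seq n_gt0) hc.
exact: triple_tame.
Qed.

Lemma triple_phase1 : triple n (within n n) phase1 (within n n).
Proof.
apply: (triple_seq n_gt0 (Q := within n n)); last exact: triple_tame.
by apply: triple_set => s [leV leW leA]; split.
Qed.

Lemma triple_phase2 : triple n (within n n) phase2 (within n n).
Proof.
apply: triple_for_y_in_W; apply: (triple_seq n_gt0 triple_closed_nbhd).
exact: triple_tame.
Qed.

Lemma triple_phase3 : triple n (within n n) phase3 (within n n).
Proof.
apply: (triple_seq n_gt0 (Q := within n n)); first exact: triple_tame.
apply: (triple_seq n_gt0 (Q := within n n)); last exact: triple_tame.
apply: triple_for_y_in_W; apply: (triple_if n_gt0); first exact: triple_skip.
apply: (triple_seq n_gt0 triple_closed_nbhd).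
exact: triple_tame.
Qed.

Lemma triple_ACCN : triple n (within n n) ACCN (within n n).
Proof.
apply: (triple_seq n_gt0 triple_phase1).
apply: (triple_seq n_gt0 triple_phase2).
apply: (triple_seq n_gt0 triple_phase3).
exact: triple_skip.
Qed.

End Sizes.

Theorem mainTheorem4 :
  exists c : nat,
    forall (K : finType) (G : graph K) (u : K) (uV : u \notin vertices G)
           (vs : seq K),
      listing G vs ->
      steps ACCN (load G vs) <= c * #|vertices (join uV)| ^ 3.
Proof.
exists (weight ACCN) => K G u uV vs [vs_uniq vsE].
have card_W : #|vertices (join uV)| = (size vs).+1.
  by rewrite /= cardsU1 uV -(eq_card vsE) (card_uniqP vs_uniq).
rewrite card_W.
(* In the initial memory |W| and the length of C(y) are still 0. *)
have ws : within (size vs).+1 (size vs).+1 (load G vs) by split.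
by have [_] := triple_ACCN (ltn0Sn _) ws.
Qed.
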